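(* Let $d\in\mathbb{N}$, let $(\Gamma,\leq_\Gamma)$ be a well-quasi-order, and let $\Sigma_{d,\Gamma}$ be the generalized level-$d$ priority alphabet over $\Gamma$. Then $(\Sigma_{d,\Gamma}^*,\sqsubseteq_{\mathrm{p},\Gamma})$, the set of finite words over $\Sigma_{d,\Gamma}$ with the generalized priority embedding, is a well-quasi-order.
   Context: For $d\in\mathbb{N}$ and a well-quasi-order $(\Gamma,\leq_\Gamma)$, $\Sigma_{d,\Gamma}=\{(a,w)\mid a\in\mathbb{N},\ 0\le a\le d,\ w\in\Gamma\}$. For $0\le a\le d$, $\Sigma_{a,\Gamma}^*\subseteq\Sigma_{d,\Gamma}^*$ is the set of words all of whose letters have first component at most $a$. The generalized priority embedding on $\Sigma_{d,\Gamma}^*$: $x\sqsubseteq_{\mathrm{p},\Gamma}y$ iff, writing $x=(a_1,v_1)\cdots(a_\ell,v_\ell)$, the word $y$ can be factored as $y=y_1\,(a_1,w_1)\,y_2\,(a_2,w_2)\cdots y_\ell\,(a_\ell,w_\ell)$ with $y_i\in\Sigma_{a_i,\Gamma}^*$ and $v_i\leq_\Gamma w_i$ for all $i=1,\ldots,\ell$. (In particular $\epsilon\sqsubseteq_{\mathrm{p},\Gamma}y$ iff $y=\epsilon$.) A quasi-order $(A,\leq_A)$ is a well-quasi-order if every infinite sequence $x_0,x_1,\ldots$ over $A$ has indices $i<j$ with $x_i\leq_A x_j$. *)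

(* Defs.v *)
From Stdlib Require Import RelationClasses.
From mathcomp Require Import all_boot.

Set Implicit Arguments.
Unset Strict Implicit.
Unset Printing Implicit Defensive.

Definition well_quasi_order (A : Type) (leA : A -> A -> Prop) : Prop :=
  PreOrder leA /\
  forall x : nat -> A, exists i j : nat, i < j /\ leA (x i) (x j).

(* The ordinal type 'I_d.+1 is {0, ..., d}. *)
Definition priority_letter (d : nat) (Gamma : Type) : Type :=
  ('I_d.+1 * Gamma)%type.

Definition priority_word (d : nat) (Gamma : Type) : Type :=
  seq (priority_letter d Gamma).

Definition priority_le (d : nat) (Gamma : Type) (a : nat)
    (u : priority_word d Gamma) : bool :=
  all (fun s : priority_letter d Gamma => s.1 <= a) u.

(* With x = (a_0, v_0) ... (a_(l-1), v_(l-1)), the big concatenation is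
   u_0 (a_0, w_0) u_1 (a_1, w_1) ... u_(l-1) (a_(l-1), w_(l-1)). *)
Definition priority_embedding (d : nat) (Gamma : Type)
    (leG : Gamma -> Gamma -> Prop) (x y : priority_word d Gamma) : Prop :=
  let a (i : 'I_(size x)) : 'I_d.+1 := (tnth (in_tuple x) i).1 in
  let v (i : 'I_(size x)) : Gamma := (tnth (in_tuple x) i).2 in
  exists (u : 'I_(size x) -> priority_word d Gamma)
         (w : 'I_(size x) -> Gamma),
    y = \big[cat/[::]]_(i < size x) (u i ++ [:: (a i, w i)]) /\
    forall i : 'I_(size x), priority_le (a i) (u i) /\ leG (v i) (w i).

(* Main.v *)
(** Call a relation almost full when every infinite sequence has a pair of
    related terms in the right order.  Almost fullness passes to products and
    options, and to finite sequences under Higman's embedding, by the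
    Nash-Williams minimal bad sequence argument.

    By induction on [a], the words with priorities [< a] are almost full.  For
    the step, cut a word with priorities [<= a] before each letter of priority
    [a]: it becomes an initial word [x0] with priorities [< a], followed by
    blocks [s x] where [s] has priority [a] and [x] has priorities [< a].  If
    there are blocks on both sides, then it suffices for the embedding that the
    initial words embed, that the last blocks embed, and that the other blocks
    satisfy Higman's embedding: a skipped block lands in the gap before the head
    of a later block, and that head, having priority [a], allows every letter
    there.  The last block has to be kept apart, as nothing may follow the last
    letter of the embedded word. *)

From Stdlib Require Import ClassicalEpsilon.
Require Import Defs.
From mathcomp Require Import all_boot.

Set Implicit Arguments.
Unset Strict Implicit.
Unset Printing Implicit Defensive.

(** * Almost full relations, products and options *)

Definition good A (R : A -> A -> Prop) (f : nat -> A) : Prop :=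
  exists i j : nat, i < j /\ R (f i) (f j).

Definition almost_full A (R : A -> A -> Prop) : Prop := forall f, good R f.

Definition transitive_rel A (R : A -> A -> Prop) : Prop :=
  forall y x z, R x y -> R y z -> R x z.

Lemma choice_function A B (R : A -> B -> Prop) :
  (forall x, exists y, R x y) -> exists f, forall x, R x (f x).
Proof.
move=> RP; exists (fun x => sval (constructive_indefinite_description _ (RP x))).
by move=> x; case: constructive_indefinite_description.
Qed.

Lemma almost_full_comp A B (R : B -> B -> Prop) (h : A -> B) :
  almost_full R -> almost_full (fun x y => R (h x) (h y)).
Proof. by move=> afR f; apply: (afR (h \o f)). Qed.

Lemma almost_full_sub A (R S : A -> A -> Prop) :
  (forall x y, R x y -> S x y) -> almost_full R -> almost_full S.
Proof. by move=> RS afR f; have [i [j [ij /RS]]] := afR f; exists i, j. Qed.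

(** Otherwise there are arbitrarily late terms related to no later term, and these form a bad
    subsequence. *)
Lemma almost_full_eventually_related A (R : A -> A -> Prop) (f : nat -> A) :
  almost_full R ->
  exists N, forall n, N <= n -> exists m, n < m /\ R (f n) (f m).
Proof.
move=> afR; apply: NNPP => noN.
have /choice_function[h hP] : forall N, exists n,
    N <= n /\ forall m, n < m -> ~ R (f n) (f m).
  move=> N; apply: NNPP => noh; apply: noN; exists N.
  move=> n Nn; apply: NNPP => nom; apply: noh; exists n; split=> // m nm Rnm.
  by apply: nom; exists m.
pose k := fix k n := if n is n'.+1 then h (k n').+1 else h 0.
have k_incr : {homo k : i j / i < j}.
  by apply: homo_ltn => [y x z|i /=]; [exact: ltn_trans | exact: (hP _).1].
have [i [j [/k_incr ij Rij]]] := afR (f \o k).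
by case: i ij Rij => [|i] ij; [apply: (hP 0).2 | apply: (hP (k i).+1).2].
Qed.

(** Start late enough and keep jumping to a later related term; transitivity relates all pairs. *)
Lemma almost_full_subsequence A (R : A -> A -> Prop) (f : nat -> A) :
  almost_full R -> transitive_rel R ->
  exists g : nat -> nat,
    forall i j, i < j -> g i < g j /\ R (f (g i)) (f (g j)).
Proof.
move=> afR trR; have [N NP] := almost_full_eventually_related f afR.
have /choice_function[h hP] : forall n, exists m, N <= n ->
    n < m /\ R (f n) (f m).
  move=> n; have [/NP [m]|_] := boolP (N <= n).
    by exists m.
  (* Dummy value: [h] is only iterated from [N] on. *)
  by exists 0.
pose g n := iter n h N.
have Ng n : N <= g n.
  by elim: n => //= n IHn; apply: leq_trans IHn (ltnW (hP _ IHn).1).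
exists g; apply: (homo_ltn (r := fun n m => n < m /\ R (f n) (f m))).
  move=> y x z [xy Rxy] [yz Ryz]; split; first exact: ltn_trans yz.
  exact: trR Ryz.
by move=> i; apply: hP.
Qed.

Lemma almost_full_prod A B (R : A -> A -> Prop) (S : B -> B -> Prop) :
  transitive_rel R -> almost_full R -> almost_full S ->
  almost_full (fun p q : A * B => R p.1 q.1 /\ S p.2 q.2).
Proof.
move=> trR afR afS f.
have [g gP] := almost_full_subsequence (fst \o f) afR trR.
have [i [j [ij Sij]]] := afS (snd \o f \o g).
by have [gij Rij] := gP _ _ ij; exists (g i), (g j).
Qed.

Definition option_rel A (R : A -> A -> Prop) (o o' : option A) : Prop :=
  match o, o' with
  | None, None => True
  | Some x, Some y => R x y
  | _, _ => False
  end.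

Lemma almost_full_option A (R : A -> A -> Prop) :
  almost_full R -> almost_full (option_rel R).
Proof.
move=> afR f; apply: NNPP => badf.
(* Two occurrences of [None] would be a good pair, so [N] can be taken past the only one. *)
have [N NP] : exists N, forall n, f (N + n) <> None.
  apply: NNPP => noN; apply: (noN); case: (classic (exists i, f i = None)).
    move=> [i fi]; exists i.+1 => n fn; apply: badf; exists i, (i.+1 + n).
    by rewrite leq_addr fi fn.
  by move=> nofi; exists 0 => n fn; apply: nofi; exists (0 + n).
case fN: (f (N + 0)) (NP 0) => [a|] // _.
have [i [j [ij Rij]]] := afR (fun n => odflt a (f (N + n))).
apply: badf; exists (N + i), (N + j); rewrite ltn_add2l; split=> //.
by case: (f (N + i)) (NP i) Rij; case: (f (N + j)) (NP j).
Qed.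

(** * Higman's lemma by minimal bad sequences *)

Lemma minimal_bad_sequence A (size : A -> nat) (R : A -> A -> Prop) f0 :
  ~ good R f0 ->
  exists2 f, ~ good R f &
    forall g n, ~ good R g -> (forall i, i < n -> g i = f i) ->
      size (f n) <= size (g n).
Proof.
move=> bad0.
have /choice_function[step stepP] :
    forall nf : nat * (nat -> A), exists g, ~ good R nf.2 ->
    [/\ ~ good R g, forall i, i < nf.1 -> g i = nf.2 i &
        forall h, ~ good R h -> (forall i, i < nf.1 -> h i = nf.2 i) ->
          size (g nf.1) <= size (h nf.1)].
  move=> [n f] /=.
  have [badf|goodf] := classic (~ good R f); last by exists f.
  (* Induction on a bound [k] for the size of the [n]-th term finds a minimal one. *)
  suff: forall k g, size (g n) <= k -> ~ good R g ->
      (forall i, i < n -> g i = f i) -> exists g, ~ good R f ->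
      [/\ ~ good R g, forall i, i < n -> g i = f i &
       forall h, ~ good R h -> (forall i, i < n -> h i = f i) ->
         size (g n) <= size (h n)].
    by move=> /(_ _ f (leqnn _) badf); apply.
  elim=> [|k IHk] g gk badg gf.
    exists g => _; split=> // h _ _.
    by move: gk; rewrite leqn0 => /eqP->.
  apply: NNPP => nog; apply: (nog); exists g => _; split=> // h badh hf.
  rewrite leqNgt; apply/negP => hg; apply: nog; apply: (IHk h) => //.
  by rewrite -ltnS; apply: leq_trans hg gk.
pose F := fix F n := if n is n'.+1 then step (n', F n') else f0.
have badF n : ~ good R (F n).
  by elim: n => //= n IHn; have [] := stepP (n, F n) IHn.
have FS n i : i < n -> F n.+1 i = F n i.
  by have [_ + _] := stepP (n, F n) (badF n); apply.
(* Step [n] minimizes the [n]-th term and later steps keep it, so the diagonal agrees with [F n]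
   below [n]. *)
pose f n := F n.+1 n.
have Ff n i : i < n -> F n i = f i.
  elim: n => // n IHn; rewrite ltnS leq_eqVlt => /orP[/eqP-> //|lt_in].
  by rewrite FS ?IHn.
exists f => [[i [j [ij Rij]]]|g n badg gf].
  apply: (badF j.+1); exists i, j; split=> //.
  by rewrite !Ff // ltnS ltnW.
have [_ _] := stepP (n, F n) (badF n); apply=> // i ltin.
by rewrite gf //= Ff.
Qed.

Inductive higman A (R : A -> A -> Prop) : seq A -> seq A -> Prop :=
| higman_nil l : higman R [::] l
| higman_skip b l m : higman R l m -> higman R l (b :: m)
| higman_cons a b l m : R a b -> higman R l m -> higman R (a :: l) (b :: m).

Lemma almost_full_higman A (R : A -> A -> Prop) :
  transitive_rel R -> almost_full R -> almost_full (higman R).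
Proof.
move=> trR afR f0; apply: NNPP => /(minimal_bad_sequence size)[f badf minf].
have f_neq0 n : f n <> [::].
  by move=> fn; apply: badf; exists n, n.+1; rewrite fn; split=> //; constructor.
case f0E: (f 0) (f_neq0 0) => [|a0 l0] // _.
pose q n := head a0 (f n); pose t n := behead (f n).
have fE n : f n = q n :: t n by rewrite /q /t; case: (f n) (f_neq0 n).
have [g gP] := almost_full_subsequence q afR trR.
have g_ge k : g 0 <= g k by case: k => // k; apply: ltnW; have [] := gP 0 k.+1.
(* From [g 0] on, use the tails of the terms whose heads increase along [g]. A good pair of [h]
   would give one of [f], yet [h] is shorter at [g 0]. *)
pose h n := if n < g 0 then f n else t (g (n - g 0)).
have badh : ~ good (higman R) h.
  move=> [i [j [ij]]]; rewrite /h; case: (ltnP i (g 0)) => i0.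
    case: (ltnP j (g 0)) => j0 Rij; apply: badf.
      by exists i, j.
    exists i, (g (j - g 0)); rewrite (leq_trans i0 (g_ge _)).
    by split=> //; rewrite (fE (g _)); constructor.
  have j0 := leq_trans i0 (ltnW ij); rewrite ltnNge j0 /= => Rij.
  have [] := gP (i - g 0) (j - g 0).
    by rewrite ltn_sub2r // (leq_ltn_trans i0).
  move=> gij Rq; apply: badf; exists (g (i - g 0)), (g (j - g 0)); split=> //.
  by rewrite !fE; constructor.
have := minf h (g 0) badh; rewrite {2}/h ltnn subnn fE /= ltnn => absurd.
by suff: false by []; apply: absurd => i; rewrite /h => ->.
Qed.

(** * The priority embedding in inductive form *)

Section PriorityEmbedding.

Variables (d : nat) (Gamma : Type) (leG : Gamma -> Gamma -> Prop).
Hypothesis leG_refl : forall v, leG v v.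
Hypothesis leG_trans : transitive_rel leG.

Local Notation word := (priority_word d Gamma).
Local Notation letter := (priority_letter d Gamma).

Inductive pemb : word -> word -> Prop :=
| pemb_nil : pemb [::] [::]
| pemb_cons (s : letter) u w x y :
    priority_le s.1 u -> leG s.2 w -> pemb x y ->
    pemb (s :: x) (u ++ (s.1, w) :: y).

Lemma priority_embeddingP x y : priority_embedding leG x y <-> pemb x y.
Proof.
split=> [[u [w [-> uwP]]]|].
  elim: x u w uwP => [|s x IHx] u w uwP; first by rewrite big_ord0; constructor.
  rewrite big_ord_recl -catA /=; have [] := uwP ord0.
  rewrite (tnth_nth s) /= => su sw; constructor=> //.
  have tnthS i : tnth (in_tuple (s :: x)) (lift ord0 i) = tnth (in_tuple x) i.
    by rewrite !(tnth_nth s).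
  under eq_bigr do rewrite tnthS.
  by apply: (IHx (fun i => u (lift ord0 i))) => i; rewrite -tnthS.
elim=> [|s u w {}x {}y su sw _ [u' [w' [-> uwP]]]].
  exists (fun => [::]).
  have no_w (i : 'I_(size ([::] : word))) : Gamma by case: i.
  by exists no_w; rewrite big_ord0; split=> // -[].
exists (fun i => if unlift ord0 i is Some j then u' j else u).
exists (fun i => if unlift ord0 i is Some j then w' j else w).
have tnthS i : tnth (in_tuple (s :: x)) (lift ord0 i) = tnth (in_tuple x) i.
  by rewrite !(tnth_nth s).
split=> [|i].
  rewrite big_ord_recl unlift_none (tnth_nth s) -catA /=; congr (_ ++ _ :: _).
  by apply: eq_bigr => i _; rewrite liftK tnthS.
case: unliftP => [j|] ->; first by rewrite tnthS.
by rewrite (tnth_nth s).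
Qed.

Lemma pemb_refl x : pemb x x.
Proof.
by elim: x => [|[a v] x IHx]; [constructor | apply: (@pemb_cons (a, v) [::])].
Qed.

Lemma pemb_cat x y x' y' : pemb x y -> pemb x' y' -> pemb (x ++ x') (y ++ y').
Proof.
by elim=> // s u w {}x {}y su sw _ IH /IH; rewrite -catA; constructor.
Qed.

Lemma pemb_skip (s : letter) x u y :
  priority_le s.1 u -> pemb (s :: x) y -> pemb (s :: x) (u ++ y).
Proof.
move=> su; move E: (s :: x) => sx sxy; case: sxy E su => // s' u' w x' {}y.
move=> su' sw xy [-> _] su; rewrite catA; constructor=> //.
by rewrite /priority_le all_cat; apply/andP.
Qed.

Lemma pemb_catl u v z : pemb (u ++ v) z ->
  exists z1 z2, [/\ z = z1 ++ z2, pemb u z1 & pemb v z2].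
Proof.
elim: u z => [|s u IHu] z; first by exists [::], z; split=> //; constructor.
move E: ((s :: u) ++ v) => suv suvz; case: suvz E => // s' u' w x y su sw xy.
case=> -> E; move: xy; rewrite -E => /IHu[z1 [z2 [-> uz1 vz2]]].
by exists (u' ++ (s'.1, w) :: z1), z2; rewrite -catA; split=> //; constructor.
Qed.

(** A letter of [z] either is the image of a letter of [u], with the same priority, or lies in a gap
    bounded by such a priority. *)
Lemma pemb_priority_le a u z : pemb u z -> priority_le a u -> priority_le a z.
Proof.
elim=> // s u' w x y su _ _ IH /= /andP[sa /IH ya].
rewrite /priority_le all_cat /= sa -/(priority_le a y) ya !andbT.
by apply: sub_all su => r rs; apply: leq_trans sa.
Qed.

Lemma pemb_trans : transitive_rel pemb.
Proof.
move=> y x z xy; elim: xy z => // s u w {}x {}y su sw _ IH z.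
move=> /pemb_catl[z1 [z2 [-> uz1]]].
move E: ((s.1, w) :: y) => sy syz2.
case: syz2 E => // s' u' w' {}x' y' su' sw' xy' [Es Ey]; subst s' x'.
(* The gap before the image of [s] consists of the image [z1] of the old gap [u] and the new gap
   [u']. *)
rewrite catA /=; constructor; last exact: IH.
  rewrite /priority_le all_cat; apply/andP; split=> //.
  exact: pemb_priority_le uz1 su.
exact: leG_trans sw'.
Qed.

(** * Decomposition of words into blocks *)

Definition letters_below a (x : word) : word := [seq s : letter <- x | s.1 < a].

Lemma letters_below_id a (x : word) :
  all (fun s : letter => s.1 < a) x -> letters_below a x = x.
Proof. by move/all_filterP. Qed.

Definition block : Type := (letter * word)%type.

Definition is_block a (b : block) : bool :=
  (b.1.1 == a :> nat) && all (fun s : letter => s.1 < a) b.2.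

(* Filtering lets the induction hypothesis, which is about words with priorities
   below [a], be used as almost fullness of a relation on all words. *)
Definition block_le a (b c : block) : Prop :=
  leG b.1.2 c.1.2 /\ pemb (letters_below a b.2) (letters_below a c.2).

Definition block_word (b : block) : word := b.1 :: b.2.

Definition blocks_word (l : seq block) : word := flatten (map block_word l).

Definition decomposition : Type := (word * option (seq block * block))%type.

Definition decomposition_word (p : decomposition) : word :=
  p.1 ++ (if p.2 is Some (l, b) then blocks_word (rcons l b) else [::]).

Definition is_decomposition a (p : decomposition) : bool :=
  all (fun s : letter => s.1 < a) p.1 &&
  (if p.2 is Some (l, b) then all (is_block a) (rcons l b) else true).

(** Read from the right: a letter below [a] joins the initial word, while a letter of priority [a]
    turns the initial word into a new first block. *)
Lemma decompositionP a (x : word) : priority_le a x ->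
  exists p, is_decomposition a p /\ decomposition_word p = x.
Proof.
elim: x => [|s x IHx] /=; first by exists ([::], None).
case/andP=> sa /IHx[[x0 o] [/andP[/= x0a oa] <-]].
have [lt_sa|ge_sa] := ltnP s.1 a.
  by exists (s :: x0, o); rewrite /is_decomposition /= lt_sa x0a oa.
have sb : is_block a (s, x0) by rewrite /is_block /= eqn_leq sa ge_sa.
case: o oa => [[l b]|] oa.
  exists ([::], Some ((s, x0) :: l, b)).
  by rewrite /is_decomposition /= sb oa /decomposition_word.
exists ([::], Some ([::], (s, x0))).
by rewrite /is_decomposition /= sb /decomposition_word /blocks_word /= cats0.
Qed.

Lemma block_priority_le a b : is_block a b -> priority_le a (block_word b).
Proof.
case/andP=> /eqP ba xa; rewrite /block_word /= ba leqnn.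
by apply: sub_all xa => s /ltnW.
Qed.

Lemma blocks_priority_le a l :
  all (is_block a) l -> priority_le a (blocks_word l).
Proof.
elim: l => // b l IHl /andP[/block_priority_le ba /IHl la].
have -> : blocks_word (b :: l) = block_word b ++ blocks_word l by [].
by rewrite /priority_le all_cat; apply/andP.
Qed.

Lemma pemb_block a b c :
  is_block a b -> is_block a c -> block_le a b c ->
  pemb (block_word b) (block_word c).
Proof.
move: b c => [[i v] x] [[j w] y] /andP[/= /eqP ia xa] /andP[/= /eqP ja ya] [/=].
rewrite !letters_below_id // => vw xy.
have -> : j = i by apply: val_inj; rewrite /= ia ja.
exact: (@pemb_cons (i, v) [::]).
Qed.

Lemma pemb_blocks a l m b c :
  all (is_block a) l -> all (is_block a) m -> is_block a b -> is_block a c ->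
  higman (block_le a) l m -> block_le a b c ->
  pemb (blocks_word (rcons l b)) (blocks_word (rcons m c)).
Proof.
move=> la ma ba ca lm bc; have bcw := pemb_block ba ca bc.
elim: lm la ma => {l m} [m|c' l m _ IH|b' c' l m bc' _ IH] /=.
(* All of [m] goes into the gap before the head of [c]. *)
- move=> _ ma; rewrite /blocks_word -cats1 map_cat flatten_cat /= !cats0.
  apply: pemb_skip bcw; have /andP[/eqP-> _] := ba.
  exact: blocks_priority_le.
- move=> la /andP[ca' ma]; have := IH la ma.
  have: all (is_block a) (rcons l b) by rewrite all_rcons ba.
  (* Thanks to [b], some block remains to be embedded, and the gap before the image of its head
     absorbs [c']. *)
  case E: (rcons l b) => [|e l']; first by case: l {IH la} E.
  case/andP=> /andP[/eqP ea _] _; apply: pemb_skip.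
  by rewrite ea; apply: block_priority_le.
- case/andP=> ba' la /andP[ca' ma]; apply: pemb_cat; last exact: IH.
  exact: pemb_block bc'.
Qed.

Lemma pemb_decomposition a p q :
  is_decomposition a p -> is_decomposition a q ->
  pemb (letters_below a p.1) (letters_below a q.1) ->
  option_rel (fun k k' => block_le a k.2 k'.2 /\ higman (block_le a) k.1 k'.1)
    p.2 q.2 ->
  pemb (decomposition_word p) (decomposition_word q).
Proof.
case: p q => [x o] [y o'] /andP[/= xa oa] /andP[/= ya oa'].
rewrite !letters_below_id // => xy oo'; apply: pemb_cat => //=.
case: o o' oa oa' oo' => [[l b]|] [[m c]|] //=; last by constructor.
rewrite !all_rcons => /andP[ba la] /andP[ca ma] [bc lm].
exact: pemb_blocks lm bc.
Qed.

Lemma almost_full_pemb_below a :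
  almost_full leG ->
  almost_full (fun x y => pemb (letters_below a x) (letters_below a y)).
Proof.
move=> afG; elim: a => [|a IHa].
  have below0 x : letters_below 0 x = [::] by elim: x.
  by move=> f; exists 0, 1; rewrite !below0; split=> //; constructor.
have tr_below :
    transitive_rel (fun x y => pemb (letters_below a x) (letters_below a y)).
  by move=> y x z; apply: pemb_trans.
have tr_block : transitive_rel (block_le a).
  move=> c b e [bc bc'] [ce ce']; split; first exact: leG_trans ce.
  exact: tr_below ce'.
have af_block : almost_full (block_le a).
  have afL : almost_full (fun s t : letter => leG s.2 t.2).
    exact: almost_full_comp.
  by apply: almost_full_prod afL IHa => t s r; apply: leG_trans.
have af_blocks :
    almost_full (fun k k' : seq block * block =>
      block_le a k.2 k'.2 /\ higman (block_le a) k.1 k'.1).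
  have := almost_full_higman tr_block af_block.
  move/(almost_full_prod tr_block af_block).
  by move/(almost_full_comp (fun k : seq block * block => (k.2, k.1))).
have af_decomposition :=
  almost_full_prod tr_below IHa (almost_full_option af_blocks).
(* A choice of decompositions pulls almost fullness back from decompositions to words. *)
have /choice_function[dec decP] : forall x, exists p,
    is_decomposition a p /\ decomposition_word p = letters_below a.+1 x.
  move=> x; apply: decompositionP.
  exact: filter_all.
apply: almost_full_sub (almost_full_comp dec af_decomposition) => x y [].
have [xa <-] := decP x; have [ya <-] := decP y.
exact: pemb_decomposition.
Qed.

Lemma almost_full_pemb : almost_full leG -> almost_full pemb.
Proof.
move/(almost_full_pemb_below d.+1); apply: almost_full_sub => x y.
(* Priorities are at most [d], so filtering below [d.+1] changes nothing. *)
have all_below (z : word) : all (fun s : letter => s.1 < d.+1) z.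
  by elim: z => //= s z ->; rewrite ltn_ord.
by rewrite !letters_below_id.
Qed.

End PriorityEmbedding.

Theorem theorem3p6 (d : nat) (Gamma : Type) (leG : Gamma -> Gamma -> Prop)
    (hG : well_quasi_order leG) :
  well_quasi_order (@priority_embedding d Gamma leG).
Proof.
have [[leG_refl leG_tr] afG] := hG.
have leG_trans : transitive_rel leG by move=> y x z; apply: leG_tr.
split; first split.
- by move=> x; apply/priority_embeddingP; apply: pemb_refl.
- move=> x y z /priority_embeddingP xy /priority_embeddingP yz.
  by apply/priority_embeddingP; apply: pemb_trans yz.
- apply: almost_full_sub (almost_full_pemb leG_trans afG) => x y.
  by move/priority_embeddingP.
Qed.
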